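(* Let $N:\mathcal{A}\to\mathcal{A}$ be a Nijenhuis operator on an associative conformal algebra $\mathcal{A}$. Then $N$ is also a Nijenhuis operator of the commutator Lie conformal algebra $\mathcal{A}^L$, and for all $a,b\in\mathcal{A}$ $$[a_\lambda b]^N=a\circ^N_\lambda b-b\circ^N_{-\lambda-\partial}a,$$ where $[a_\lambda b]^N:=[N(a)_\lambda b]^L+[a_\lambda N(b)]^L-N([a_\lambda b]^L)$ and $a\circ^N_\lambda b:=N(a)_\lambda b+a_\lambda N(b)-N(a_\lambda b)$; that is, the deformed $\lambda$-bracket is the commutator of the deformed associative $\lambda$-product.
   Context: All vector spaces are over $\mathbb{C}$. An associative conformal algebra is a $\mathbb{C}[\partial]$-module $\mathcal{A}$ with a $\mathbb{C}$-bilinear map $\mathcal{A}\times\mathcal{A}\to\mathcal{A}[\lambda]$, $(a,b)\mapsto a_\lambda b$, such that $(\partial a)_\lambda b=-\lambda\,a_\lambda b$, $a_\lambda(\partial b)=(\partial+\lambda)(a_\lambda b)$ and $(a_\lambda b)_{\lambda+\mu}c=a_\lambda(b_\mu c)$ for all $a,b,c\in\mathcal{A}$. Maps are extended coefficientwise to polynomials. For a product with $b_\mu a=\sum_j\mu^jc_j$, one sets $b_{-\lambda-\partial}a:=\sum_j(-\lambda-\partial)^jc_j$ (similarly for $\circ^N$). The commutator Lie conformal algebra $\mathcal{A}^L$ is the $\mathbb{C}[\partial]$-module $\mathcal{A}$ with $\lambda$-bracket $[a_\lambda b]^L=a_\lambda b-b_{-\lambda-\partial}a$. A Nijenhuis operator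 on the associative conformal algebra $\mathcal{A}$ is a $\mathbb{C}[\partial]$-module homomorphism $N:\mathcal{A}\to\mathcal{A}$ with $N(a)_\lambda N(b)=N\big(N(a)_\lambda b+a_\lambda N(b)-N(a_\lambda b)\big)$ for all $a,b\in\mathcal{A}$. A Nijenhuis operator of a Lie conformal algebra $(\mathcal{L},[\cdot_\lambda\cdot])$ is a $\mathbb{C}[\partial]$-module homomorphism $N:\mathcal{L}\to\mathcal{L}$ with $[N(a)_\lambda N(b)]=N\big([N(a)_\lambda b]+[a_\lambda N(b)]-N([a_\lambda b])\big)$ for all $a,b\in\mathcal{L}$. *)

(* Defs.v *)
From HB Require Import structures.
From mathcomp Require Import all_boot all_order all_algebra.
From mathcomp Require Import ring.
From mathcomp Require Import reals.
From mathcomp Require Import complex.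
From mathcomp Require Import finmap.
From mathcomp Require Import monalg.

Set Implicit Arguments.
Unset Strict Implicit.
Unset Printing Implicit Defensive.

Import GRing.Theory.
Local Open Scope ring_scope.

(* [polymod V] is V[X], the polynomials with coefficients in an R-module V,  *)
(* as a module over R[X].                                                    *)
Definition polymod (R : nzRingType) (V : lmodType R) := {malg V[nat]}.

Section PolyMod.
Variables (R : nzRingType) (V : lmodType R).

HB.instance Definition _ := GRing.Zmodule.copy (polymod V) {malg V[nat]}.

Definition pscale (p : {poly R}) (v : polymod V) : polymod V :=
  \sum_(i < size p) \sum_(k <- msupp v) << p`_i *: v@_k *g (i + k)%N >>.

Lemma mcoeff_shift (a : R) (i n : nat) (v : polymod V) :
  (\sum_(k <- msupp v) << a *: v@_k *g (i + k)%N >>)@_n =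
  if (i <= n)%N then a *: v@_(n - i)%N else 0.
Proof.
rewrite raddf_sum /=; case: leqP => [le_in | lt_ni]; last first.
  rewrite big1 // => k _; rewrite mcoeffU; case: eqP => // E.
  by move: lt_ni; rewrite -E ltnNge leq_addr.
have [kv|kNv] := boolP ((n - i)%N \in msupp v).
  rewrite (big_fsetD1 (n - i)%N) //= mcoeffU subnKC // eqxx mulr1n.
  rewrite big1_fset ?addr0 // => k; rewrite in_fsetD1 => /andP[kn _] _.
  by rewrite mcoeffU -(subnKC le_in) eqn_add2l (negPf kn).
rewrite (mcoeff_outdom kNv) scaler0 big1_fset // => k kv _.
rewrite mcoeffU -(subnKC le_in) eqn_add2l; case: eqP => // E.
by move: kNv; rewrite -E kv.
Qed.

Lemma mcoeff_pscale (p : {poly R}) (v : polymod V) (n : nat) :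
  (pscale p v)@_n = \sum_(i < n.+1) p`_i *: v@_(n - i)%N.
Proof.
rewrite /pscale raddf_sum /=.
under eq_bigr => i _ do rewrite mcoeff_shift.
rewrite -(big_mkord predT
  (fun i => if (i <= n)%N then p`_i *: v@_(n - i)%N else 0)).
rewrite -(big_mkord predT (fun i => p`_i *: v@_(n - i)%N)) /=.
pose F i := if (i <= n)%N then p`_i *: v@_(n - i)%N else 0.
transitivity (\sum_(0 <= i < maxn (size p) n.+1) F i).
  rewrite (big_cat_nat (leq0n _) (leq_maxl (size p) n.+1)) /=.
  rewrite [X in _ = _ + X]big_nat [X in _ = _ + X]big1 ?addr0 //.
  by move=> i /andP[le_pi _]; rewrite /F nth_default // scale0r if_same.
rewrite (big_cat_nat (leq0n _) (leq_maxr (size p) n.+1)) /=.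
rewrite [X in _ + X]big_nat [X in _ + X]big1 ?addr0 => [|i /andP[lt_ni _]].
  by rewrite big_nat [RHS]big_nat; apply: eq_bigr => i /=; rewrite /F ltnS => ->.
by rewrite /F leqNgt lt_ni.
Qed.

Lemma pscaleA (p q : {poly R}) (v : polymod V) :
  pscale p (pscale q v) = pscale (p * q) v.
Proof.
apply/malgP => n; rewrite !mcoeff_pscale.
pose c3 j k := p`_j *: (q`_(n - j - k)%N *: v@_k).
transitivity (\sum_(j < n.+1) \sum_(k < n.+1 | (k <= n - j)%N) c3 j k).
  apply: eq_bigr => /= j _; rewrite mcoeff_pscale scaler_sumr.
  rewrite (big_ord_narrow_leq (leq_subr _ _)) /=.
  rewrite (reindex_inj rev_ord_inj) /=; apply: eq_bigr => k _.
  by rewrite /c3 subSS subKn // -ltnS.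
rewrite (exchange_big_dep predT) //=.
rewrite [RHS](reindex_inj rev_ord_inj) /=; apply: eq_bigr => k _.
transitivity (\sum_(j < n.+1 | (j <= n - k)%N) c3 j k).
  apply: eq_bigl => j; rewrite -ltnS -(ltnS j) -!subSn ?leq_ord //.
  by rewrite -subn_gt0 -(subn_gt0 j) -!subnDA addnC.
rewrite (big_ord_narrow_leq (leq_subr _ _)) subSS subKn ?leq_ord // coefM.
rewrite scaler_suml; apply: eq_bigr => j _ /=.
by rewrite /c3 scalerA -!subnDA addnC.
Qed.

Lemma pscale1 : left_id 1 pscale.
Proof.
move=> v; apply/malgP => n; rewrite mcoeff_pscale big_ord_recl subn0 coef1 scale1r.
by rewrite big1 ?addr0 // => i _; rewrite coef1 scale0r.
Qed.

Lemma pscaleDr : right_distributive pscale +%R.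
Proof.
move=> p v w; apply/malgP => n; rewrite mcoeffD !mcoeff_pscale -big_split /=.
by apply: eq_bigr => i _; rewrite mcoeffD scalerDr.
Qed.

Lemma pscaleDl v : {morph pscale^~ v : p q / p + q}.
Proof.
move=> p q; apply/malgP => n; rewrite mcoeffD !mcoeff_pscale -big_split /=.
by apply: eq_bigr => i _; rewrite coefD scalerDl.
Qed.

HB.instance Definition _ := GRing.Zmodule_isLmodule.Build {poly R} (polymod V)
  pscaleA pscale1 pscaleDr pscaleDl.

Lemma mcoeff_scale (p : {poly R}) (v : polymod V) (n : nat) :
  (p *: v)@_n = \sum_(i < n.+1) p`_i *: v@_(n - i)%N.
Proof. exact: mcoeff_pscale. Qed.

Definition pconst (x : V) : polymod V := << x *g 0%N >>.

(* f extended coefficientwise; meant for f 0 = 0 *)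
Definition pmap (f : V -> V) (v : polymod V) : polymod V :=
  [malg k in msupp v => f v@_k].

Definition pmono (k : nat) (x : V) : polymod V := << x *g k >>.

Lemma polymod_ind (P : polymod V -> Prop) :
  P 0 -> (forall v w, P v -> P w -> P (v + w)) ->
  (forall k x, P (pmono k x)) -> forall v, P v.
Proof.
move=> P0 PD PU v; rewrite [v]monalgE.
by elim/big_ind: _ => // k _; apply: PU.
Qed.

Lemma scaleX_mono k x : 'X *: pmono k x = pmono k.+1 x.
Proof.
apply/malgP => n; rewrite mcoeff_scale !mcoeffU.
case: n => [|n]; first by rewrite big_ord1 coefX scale0r.
rewrite big_ord_recl coefX scale0r add0r big_ord_recl coefX scale1r.
rewrite big1 ?addr0 => [|i _]; last by rewrite coefX scale0r.
by rewrite mcoeffU /bump /= subSS subn0 eqSS.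
Qed.

Lemma scaleC_mono a k x : a%:P *: pmono k x = pmono k (a *: x).
Proof.
apply/malgP => n; rewrite mcoeff_scale big_ord_recl subn0 coefC /= !mcoeffU.
by rewrite big1 ?addr0 ?scalerMnr // => i _; rewrite coefC scale0r.
Qed.

Lemma pmonoD k : {morph pmono k : x y / x + y}.
Proof. by move=> x y; rewrite /pmono raddfD. Qed.

End PolyMod.

(* Substitution: [peval phi t p] is  \sum_k t^k phi(p_k). *)
Definition peval (R S : nzRingType) (V : lmodType R) (M : lmodType S)
    (phi : V -> M) (t : S) (p : polymod V) : M :=
  \sum_(k <- msupp p) t ^+ k *: phi p@_k.

Section Peval.
Variables (R : nzRingType) (S : comNzRingType).
Variables (V : lmodType R) (M : lmodType S).
Implicit Types (phi psi : V -> M) (t : S) (p : polymod V).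

Lemma eq_peval phi psi t p : phi =1 psi -> peval phi t p = peval psi t p.
Proof. by move=> E; apply: eq_bigr => k _; rewrite E. Qed.

Lemma pevalBf phi psi t p :
  peval (fun x => phi x - psi x) t p = peval phi t p - peval psi t p.
Proof. by rewrite /peval -sumrB; apply: eq_bigr => k _; rewrite scalerBr. Qed.

Variables (phi : V -> M) (phiD : {morph phi : x y / x + y}) (t : S).

Lemma morph0 : phi 0 = 0.
Proof. by apply: (addrI (phi 0)); rewrite -phiD !addr0. Qed.

Lemma pevalEw (D : {fset nat}) p : (msupp p `<=` D)%fset ->
  peval phi t p = \sum_(k <- D) t ^+ k *: phi p@_k.
Proof.
move=> pD; rewrite /peval (big_fset_incl _ pD) // => k _ kNp.
by rewrite mcoeff_outdom // morph0 scaler0.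
Qed.

Lemma pevalD : {morph peval phi t : p q / p + q}.
Proof.
move=> p q; rewrite (pevalEw (fsubsetUl (msupp p) (msupp q))).
rewrite (pevalEw (fsubsetUr (msupp p) (msupp q))) (pevalEw (msuppD_le p q)).
by rewrite -big_split; apply: eq_bigr => k _ /=; rewrite mcoeffD phiD scalerDr.
Qed.

Lemma peval0 : peval phi t 0 = 0.
Proof. by rewrite /peval msupp0 big_seq_fset0. Qed.

Lemma pevalN : {morph peval phi t : p / - p}.
Proof.
by move=> p; apply: (addrI (peval phi t p)); rewrite -pevalD !subrr peval0.
Qed.

Lemma pevalB : {morph peval phi t : p q / p - q}.
Proof. by move=> p q; rewrite pevalD pevalN. Qed.

Lemma peval_mono k x : peval phi t (pmono k x) = t ^+ k *: phi x.
Proof.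
by rewrite (pevalEw msuppU_le) big_seq_fset1 mcoeffUU.
Qed.

Lemma peval_const x : peval phi t (pconst x) = phi x.
Proof. by rewrite (peval_mono 0) expr0 scale1r. Qed.

Lemma pevalX p : peval phi t ('X *: p) = t *: peval phi t p.
Proof.
elim/polymod_ind: p => [|v w Ev Ew|k x]; first by rewrite scaler0 peval0 scaler0.
  by rewrite scalerDr !pevalD Ev Ew scalerDr.
by rewrite scaleX_mono !peval_mono exprS scalerA.
Qed.

Lemma pevalC (a : R) (r : S) p : (forall x, phi (a *: x) = r *: phi x) ->
  peval phi t (a%:P *: p) = r *: peval phi t p.
Proof.
move=> phia; elim/polymod_ind: p => [|v w Ev Ew|k x].
- by rewrite scaler0 peval0 scaler0.
- by rewrite scalerDr !pevalD Ev Ew scalerDr.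
by rewrite scaleC_mono !peval_mono phia !scalerA mulrC.
Qed.

End Peval.

Lemma peval_comp (R S T : comNzRingType) (V : lmodType R) (M : lmodType S)
    (L : lmodType T) (f : M -> L) (phi : V -> M) (q : S) (r : T) p :
  {morph f : x y / x + y} -> (forall v, f (q *: v) = r *: f v) ->
  f (peval phi q p) = peval (f \o phi) r p.
Proof.
move=> fD fq; have fX k v : f (q ^+ k *: v) = r ^+ k *: f v.
  elim: k v => [|k IH] v; first by rewrite !expr0 !scale1r.
  by rewrite !exprS -!scalerA fq IH.
rewrite /peval (big_morph f fD (morph0 fD)).
by apply: eq_bigr => k _; rewrite fX.
Qed.

Lemma pconstD (R : nzRingType) (V : lmodType R) :
  {morph @pconst R V : x y / x + y}.
Proof. exact: pmonoD. Qed.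

Lemma pconstZ (R : nzRingType) (V : lmodType R) a (x : V) :
  pconst (a *: x) = a%:P *: pconst x.
Proof. by rewrite (scaleC_mono a 0 x). Qed.

Lemma peval_constX (R : comNzRingType) (V : lmodType R) (p : polymod V) :
  peval (@pconst R V) 'X p = p.
Proof.
elim/polymod_ind: p => [|v w Ev Ew|k x]; first by rewrite peval0.
  by rewrite pevalD ?Ev ?Ew //; exact: pconstD.
rewrite peval_mono; last exact: pconstD.
elim: k => [|k IH]; first by rewrite expr0 scale1r.
by rewrite exprS -scalerA IH scaleX_mono.
Qed.

Lemma jacobi_rearrange (S : comNzRingType) (M : zmodType) (X : Type)
    (L P : S -> S -> X -> X -> X -> M) (l m d : S) :
  (forall s t a b c, L s (s + t) a b c = P s t a b c) -> forall a b c,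
  P l m a b c - P l (- m - d - l) a c b
    - (L m (- l - d) b c a - L (- l - d - m) (- l - d) c b a) =
  (L l (l + m) a b c - L (l + m - l) (l + m) b a c
    - (P (- (l + m) - d) l c a b
       - P (- (l + m) - d) (- l - d - (- (l + m) - d)) c b a))
  + (P m l b a c - P m (- l - d - m) b c a
    - (L l (- m - d) a c b - L (- m - d - l) (- m - d) c a b)).
Proof.
move=> LP a b c; have LP' s u x y z : L s u x y z = P s (u - s) x y z.
  by rewrite -LP addrC subrK.
rewrite !LP'.
have -> : l + m - l = m by ring.
have -> : l + m - m = l by ring.
have -> : - l - d - (- (l + m) - d) = m by ring.
have -> : - l - d - (- l - d - m) = m by ring.
have -> : - m - d - (- m - d - l) = l by ring.
have -> : - l - d - m = - (l + m) - d by ring.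
have -> : - m - d - l = - (l + m) - d by ring.
rewrite !opprB [in RHS]addrACA !subrKA addrACA [RHS]addrACA.
by congr (_ + _); exact: addrC.
Qed.

(* A C[del]-module is an lmodType {poly C}, 'X acting as del.  For such an A *)
(*   polymod A           is A[lam],     a module over C[del][lam],           *)
(*   polymod (polymod A) is A[lam][mu], a module over C[del][lam][mu].       *)
Section LambdaProducts.
Variables (C : comNzRingType) (A : lmodType {poly C}).
Implicit Types (m : A -> A -> polymod A) (a b c : A).

(* del and lam in C[del][lam]; below, del, lam and mu in C[del][lam][mu] *)
Let del1 : {poly {poly C}} := 'X%:P.
Let lam1 : {poly {poly C}} := 'X.
Definition del : {poly {poly {poly C}}} := 'X%:P%:P.
Definition lam : {poly {poly {poly C}}} := 'X%:P.
Definition mu : {poly {poly {poly C}}} := 'X.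

Record sesquilinear m : Prop := Sesquilinear {
  lprodDl : forall a a' b, m (a + a') b = m a b + m a' b;
  lprodDr : forall a b b', m a (b + b') = m a b + m a b';
  lprodCl : forall (k : C) a b, m (k%:P *: a) b = k%:P%:P *: m a b;
  lprodCr : forall (k : C) a b, m a (k%:P *: b) = k%:P%:P *: m a b;
  lprod_dell : forall a b, m ('X *: a) b = - lam1 *: m a b;
  lprod_delr : forall a b, m a ('X *: b) = (del1 + lam1) *: m a b
}.

Definition ccst (a : A) : polymod (polymod A) := pconst (pconst a).

(* a_u b in A[lam][mu], for u in C[del][lam][mu] *)
Definition act m u a b : polymod (polymod A) := peval ccst u (m a b).

(* (a_s b)_u c *)
Definition nest_l m s u a b c : polymod (polymod A) :=
  peval (fun x => act m u x c) s (m a b).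

(* a_s (b_t c) *)
Definition nest_r m s t a b c : polymod (polymod A) :=
  peval (fun x => act m s a x) t (m b c).

(* b_{- lam - del} a *)
Definition opposite m a b : polymod A :=
  peval (@pconst _ A) (- lam1 - del1) (m b a).

Definition commutator m a b : polymod A := m a b - opposite m a b.

Definition nijenhuis m (N : A -> A) : Prop :=
  forall a b, m (N a) (N b) = pmap N (m (N a) b + m a (N b) - pmap N (m a b)).

Definition deformed m (N : A -> A) a b : polymod A :=
  m (N a) b + m a (N b) - pmap N (m a b).

Definition lassociative m : Prop :=
  forall a b c, nest_l m lam (lam + mu) a b c = nest_r m lam mu a b c.

Definition lskew m : Prop := forall a b, m a b = - opposite m a b.

Definition ljacobi m : Prop := forall a b c,
  nest_r m lam mu a b c =
  nest_l m lam (lam + mu) a b c + nest_r m mu lam b a c.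

Lemma ccstD : {morph ccst : x y / x + y}.
Proof. by move=> x y; rewrite /ccst !pconstD. Qed.

Lemma ccstX x : ccst ('X *: x) = del *: ccst x.
Proof. by rewrite /ccst !pconstZ. Qed.

Lemma peval_ccst_q u p :
  peval ccst u ((- lam1 - del1) *: p) = (- u - del) *: peval ccst u p.
Proof.
rewrite !scalerBl !scaleNr (pevalB ccstD) (pevalN ccstD) (pevalX ccstD).
by rewrite (pevalC ccstD _ _ ccstX).
Qed.

Lemma act_opposite m u a b :
  peval ccst u (opposite m a b) = act m (- u - del) b a.
Proof.
rewrite /opposite (peval_comp _ _ (pevalD ccstD u) (peval_ccst_q u)).
by apply: eq_peval => x /=; rewrite (peval_const ccstD).
Qed.

Lemma act_commutator m u a b :
  act (commutator m) u a b = act m u a b - act m (- u - del) b a.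
Proof. by rewrite {1}/act /commutator (pevalB ccstD) act_opposite. Qed.

Section Theory.
Variables (m : A -> A -> polymod A) (mS : sesquilinear m).

Lemma actDl u c : {morph (fun x => act m u x c) : x y / x + y}.
Proof. by move=> x y; rewrite /act (lprodDl mS) (pevalD ccstD). Qed.

Lemma actDr u c : {morph act m u c : x y / x + y}.
Proof. by move=> x y; rewrite /act (lprodDr mS) (pevalD ccstD). Qed.

Lemma act_dell u c x : act m u ('X *: x) c = - u *: act m u x c.
Proof.
by rewrite /act (lprod_dell mS) !scaleNr (pevalN ccstD) (pevalX ccstD).
Qed.

Lemma act_delr u c x : act m u c ('X *: x) = (del + u) *: act m u c x.
Proof.
rewrite /act (lprod_delr mS) !scalerDl (pevalD ccstD) (pevalX ccstD).
by rewrite (pevalC ccstD _ _ ccstX).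
Qed.

Lemma nest_l_opposite s u a b c :
  peval (fun x => act m u x c) s (opposite m a b) = nest_l m (u - s) u b a c.
Proof.
have D := actDl u c; have E v : peval (fun x => act m u x c) s
    ((- lam1 - del1) *: v) = (u - s) *: peval (fun x => act m u x c) s v.
  rewrite scalerBl scaleNr (pevalB D) (pevalN D) (pevalX D).
  rewrite (pevalC D _ _ (act_dell u c)) scaleNr opprK.
  by rewrite scalerBl addrC.
rewrite /opposite (peval_comp _ _ (pevalD D s) E).
by apply: eq_peval => x /=; rewrite (peval_const D).
Qed.

Lemma nest_r_opposite s t a b c :
  peval (act m s a) t (opposite m b c) = nest_r m s (- t - del - s) a c b.
Proof.
have D := actDr s a; have E v : peval (act m s a) t
    ((- lam1 - del1) *: v) = (- t - del - s) *: peval (act m s a) t v.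
  rewrite scalerBl scaleNr (pevalB D) (pevalN D) (pevalX D).
  have -> : - t - del - s = - t - (del + s) by rewrite opprD addrA.
  by rewrite (pevalC D _ _ (act_delr s a)) [in RHS]scalerBl [in RHS]scaleNr.
rewrite /opposite (peval_comp _ _ (pevalD D t) E).
by apply: eq_peval => x /=; rewrite (peval_const D).
Qed.

Lemma sesquilinear_commutator : sesquilinear (commutator m).
Proof.
have D := @pconstD _ A; rewrite /commutator /opposite.
have oD p q := pevalD D (- lam1 - del1) p q.
have oC (k : C) p : peval (@pconst _ A) (- lam1 - del1) (k%:P%:P *: p) =
    k%:P%:P *: peval (@pconst _ A) (- lam1 - del1) p.
  by apply: (pevalC D) => x; exact: pconstZ.
have oX p : peval (@pconst _ A) (- lam1 - del1) (lam1 *: p) =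
    (- lam1 - del1) *: peval (@pconst _ A) (- lam1 - del1) p.
  exact: pevalX.
have od p : peval (@pconst _ A) (- lam1 - del1) (del1 *: p) =
    del1 *: peval (@pconst _ A) (- lam1 - del1) p.
  by apply: (pevalC D) => x; exact: pconstZ.
split=> [a a' b|a b b'|k a b|k a b|a b|a b].
- by rewrite (lprodDl mS) (lprodDr mS) oD opprD addrACA.
- by rewrite (lprodDl mS) (lprodDr mS) oD opprD addrACA.
- by rewrite (lprodCl mS) (lprodCr mS) oC scalerBr.
- by rewrite (lprodCl mS) (lprodCr mS) oC scalerBr.
- rewrite (lprod_dell mS) (lprod_delr mS) scalerBr; congr (_ - _).
  by rewrite scalerDl oD oX od -scalerDl addrC subrK.
- rewrite (lprod_dell mS) (lprod_delr mS) scalerBr; congr (_ - _).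
  by rewrite scaleNr (pevalN D) oX -scaleNr opprB opprK.
Qed.

Lemma lskew_commutator : lskew (commutator m).
Proof.
have D := @pconstD _ A => a b; rewrite /opposite {2}/commutator (pevalB D).
rewrite opprB /commutator addrC [RHS]addrC -/(opposite m a b); congr (_ + _).
have E v : peval (@pconst _ A) (- lam1 - del1) ((- lam1 - del1) *: v) =
    lam1 *: peval (@pconst _ A) (- lam1 - del1) v.
  rewrite scalerBl scaleNr (pevalB D) (pevalN D) (pevalX D).
  rewrite (pevalC D _ _ (pconstZ 'X)).
  by rewrite -scaleNr -scalerBl opprB opprK addrAC subrr add0r.
rewrite /opposite (peval_comp _ _ (pevalD D _) E).
rewrite (eq_peval (psi := @pconst _ A)) ?peval_constX // => x /=.
by rewrite (peval_const D).
Qed.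

Hypothesis mA : lassociative m.

Lemma nest_assoc s t a b c : nest_l m s (s + t) a b c = nest_r m s t a b c.
Proof.
pose E0 := peval ccst s; pose E := peval E0 t.
have E0D : {morph E0 : x y / x + y} := pevalD ccstD s.
have ED : {morph E : x y / x + y} := pevalD E0D t.
have Elam v : E (lam *: v) = s *: E v.
  by apply: (pevalC E0D) => x; exact: (pevalX ccstD).
have Emu v : E (mu *: v) = t *: E v by exact: (pevalX E0D).
have Elm v : E ((lam + mu) *: v) = (s + t) *: E v.
  by rewrite !scalerDl ED Elam Emu.
have Ec x : E (ccst x) = ccst x.
  by rewrite /E /ccst (peval_const E0D) /E0 (peval_const ccstD).
have Ea q r x y : (forall v, E (q *: v) = r *: E v) ->
    E (act m q x y) = act m r x y.
  move=> Eq; rewrite /act (peval_comp _ _ ED Eq).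
  by apply: eq_peval => z /=; rewrite Ec.
have := congr1 E (mA a b c); rewrite /nest_l /nest_r.
rewrite (peval_comp _ _ ED Elam) (peval_comp _ _ ED Emu).
move=> H; apply: etrans (etrans H _); apply: eq_peval => x /=.
  exact/esym/Ea.
exact: Ea.
Qed.

Lemma peval_actl_commutator s u a b c :
  peval (fun x => act m u x c) s (commutator m a b) =
  nest_l m s u a b c - nest_l m (u - s) u b a c.
Proof.
rewrite -(nest_l_opposite s u a b c).
exact: (pevalB (actDl u c) s (m a b) (opposite m a b)).
Qed.

Lemma peval_actr_commutator s t a b c :
  peval (act m s a) t (commutator m b c) =
  nest_r m s t a b c - nest_r m s (- t - del - s) a c b.
Proof.
rewrite -(nest_r_opposite s t a b c).
exact: (pevalB (actDr s a) t (m b c) (opposite m b c)).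
Qed.

Lemma nest_l_commutator s u a b c :
  nest_l (commutator m) s u a b c =
  nest_l m s u a b c - nest_l m (u - s) u b a c
  - (nest_r m (- u - del) s c a b
     - nest_r m (- u - del) (- s - del - (- u - del)) c b a).
Proof.
apply: etrans (etrans (pevalBf _ _ s (commutator m a b)) (congr2 _
  (peval_actl_commutator s u a b c)
  (congr1 _ (peval_actr_commutator (- u - del) s c a b)))).
by apply: eq_peval => x; exact: act_commutator.
Qed.

Lemma nest_r_commutator s t a b c :
  nest_r (commutator m) s t a b c =
  nest_r m s t a b c - nest_r m s (- t - del - s) a c b
  - (nest_l m t (- s - del) b c a - nest_l m (- s - del - t) (- s - del) c b a).
Proof.
apply: etrans (etrans (pevalBf _ _ t (commutator m b c)) (congr2 _
  (peval_actr_commutator s t a b c)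
  (congr1 _ (peval_actl_commutator t (- s - del) b c a)))).
by apply: eq_peval => x; exact: act_commutator.
Qed.

Lemma ljacobi_commutator : ljacobi (commutator m).
Proof.
move=> a b c; apply: etrans (nest_r_commutator _ _ _ _ _) _.
apply: etrans (jacobi_rearrange lam mu del nest_assoc a b c) _.
exact/esym/(congr2 _ (nest_l_commutator _ _ _ _ _)
  (nest_r_commutator _ _ _ _ _)).
Qed.

End Theory.
End LambdaProducts.

Record assocConformal (C : comNzRingType) := AssocConformal {
  ac_sort :> lmodType {poly C};
  ac_prod : ac_sort -> ac_sort -> polymod ac_sort;
  ac_sesquilinear : sesquilinear ac_prod;
  ac_assoc : lassociative ac_prod
}.

Record lieConformal (C : comNzRingType) := LieConformal {
  lc_sort :> lmodType {poly C};
  lc_bracket : lc_sort -> lc_sort -> polymod lc_sort;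
  lc_sesquilinear : sesquilinear lc_bracket;
  lc_skew : lskew lc_bracket;
  lc_jacobi : ljacobi lc_bracket
}.

Definition commutatorLie (C : comNzRingType) (A : assocConformal C) :
    lieConformal C :=
  @LieConformal C A (commutator (@ac_prod C A))
    (sesquilinear_commutator (ac_sesquilinear A))
    (lskew_commutator (@ac_prod C A))
    (ljacobi_commutator (ac_sesquilinear A) (ac_assoc (a:=A))).

Definition assocNijenhuis (C : comNzRingType) (A : assocConformal C)
  (N : {linear A -> A}) : Prop := nijenhuis (@ac_prod C A) N.

Definition lieNijenhuis (C : comNzRingType) (L : lieConformal C)
  (N : {linear L -> L}) : Prop := nijenhuis (@lc_bracket C L) N.

(* Main.v *)
(** The coefficientwise extension of a C[del]-linear map N is linear over
    C[del][lam], so it commutes with the substitution lam |-> - lam - del.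
    Both claims are then additivity of [x |-> x_{- lam - del}]. *)

Require Import Defs.
From mathcomp Require Import all_boot all_order all_algebra.
From mathcomp Require Import reals complex.
From mathcomp Require Import finmap monalg.

Local Open Scope ring_scope.

Import GRing.Theory.

(* [seq.pmap] shadows the coefficientwise extension. *)
Local Notation pmap := Defs.pmap.

Section CoefficientwiseExtension.
Variables (R : comNzRingType) (V : lmodType R) (N : {linear V -> V}).
Implicit Types (p : polymod V) (q : {poly R}).

Lemma mcoeff_pmap p (n : nat) : (pmap N p)@_n = N p@_n.
Proof.
(* Outside the support the coefficient of [pmap N p] defaults to 0, which agrees with [N 0]. *)
by rewrite /pmap mcoeffE; case: ifPn => // /mcoeff_outdom ->; rewrite linear0.
Qed.

Lemma pmapB : {morph pmap N : p p' / p - p'}.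
Proof.
by move=> p p'; apply/malgP => n; rewrite !(mcoeff_pmap, mcoeffB) linearB.
Qed.

Lemma pmapD : {morph pmap N : p p' / p + p'}.
Proof.
by move=> p p'; apply/malgP => n; rewrite !(mcoeff_pmap, mcoeffD) linearD.
Qed.

Lemma pmapZ q p : pmap N (q *: p) = q *: pmap N p.
Proof.
apply/malgP => n; rewrite mcoeff_pmap !mcoeff_scale linear_sum.
by apply: eq_bigr => i _; rewrite linearZ mcoeff_pmap.
Qed.

Lemma pmap_const x : pmap N (pconst x) = pconst (N x).
Proof. by apply/malgP => n; rewrite mcoeff_pmap !mcoeffU raddfMn. Qed.

(** By [pmapZ], [pmap N] commutes with each power of [q]; on constants it acts as [N]. *)
Lemma peval_const_pmap q p :
  peval (@pconst R V) q (pmap N p) = pmap N (peval (@pconst R V) q p).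
Proof.
rewrite (@peval_comp _ _ _ _ _ _ _ _ _ q p pmapD (pmapZ q)).
(* [N] may kill coefficients and shrink the support, so both sums are taken over [msupp p]. *)
have sub : (msupp (pmap N p) `<=` msupp p)%fset.
  apply/fsubsetP => k; rewrite -!mcoeff_neq0 mcoeff_pmap.
  by apply: contraNneq => ->; rewrite linear0.
rewrite (pevalEw (@pconstD R V) q sub).
by apply: eq_bigr => k _; rewrite mcoeff_pmap /= pmap_const.
Qed.

End CoefficientwiseExtension.

Section Deformation.
Variables (C : comNzRingType) (A : lmodType {poly C}).
Variables (m : A -> A -> polymod A) (N : {linear A -> A}).

Lemma opposite_deformed a b :
  opposite (deformed m N) a b =
  opposite m (N a) b + opposite m a (N b) - pmap N (opposite m a b).
Proof.
rewrite /opposite /deformed (pevalB (@pconstD _ A)) (pevalD (@pconstD _ A)).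
(* Exchanging [a] and [b] also exchanges the two terms in which [N] hits one argument. *)
by rewrite peval_const_pmap [X in X - _ = _]addrC.
Qed.

Lemma deformed_commutator a b :
  deformed (commutator m) N a b = commutator (deformed m N) a b.
Proof.
rewrite /commutator opposite_deformed /deformed pmapB.
by rewrite !opprD [X in X + _ = _]addrACA [LHS]addrACA.
Qed.

(** The identity for [m] is used twice: at [(a, b)], and at [(b, a)] under the substitution, once
    [pmap N] has been moved inside it. *)
Lemma nijenhuis_commutator : nijenhuis m N -> nijenhuis (commutator m) N.
Proof.
move=> mN a b; rewrite -/(deformed (commutator m) N a b) deformed_commutator.
by rewrite /commutator pmapB /opposite -peval_const_pmap !mN.
Qed.

End Deformation.

Theorem theorem5p19 (R : realType) (A : assocConformal R[i])
    (N : {linear A -> A}) :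
  assocNijenhuis N ->
  lieNijenhuis (L := commutatorLie A) N /\
  forall a b : A,
    deformed (@lc_bracket _ (commutatorLie A)) N a b =
    commutator (deformed (@ac_prod _ A) N) a b.
Proof.
by move=> NA; split; [exact: nijenhuis_commutator | exact: deformed_commutator].
Qed.
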